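(* Let $p$ be a prime and let $O$ be a complete discrete valuation ring with maximal ideal $\mathfrak m$, residue field $\kappa=O/\mathfrak m$ of characteristic $p$, and field of fractions $K$ of characteristic $0$. Let $\Delta$ be a finite simple graph with vertex set $V(\Delta)$ and adjacency matrix $A$, and let $x\in\operatorname{Aut}(\Delta)$ have order $p$, with permutation matrix $T$ and fixed vertex set $\mathcal F$. Let $E\in\operatorname{End}_O\bigl(O^{V(\Delta)}\bigr)$ be an idempotent commuting with $T$, and put $L=EO^{V(\Delta)}$. Then $$\operatorname{tr}\bigl(x\mid K\otimes_O L\bigr)=\operatorname{tr}(TE)=\operatorname{rank}_\kappa\bigl(E[\mathcal F]\bmod\mathfrak m\bigr),$$ where $E[\mathcal F]$ is the principal submatrix of $E$ on the rows and columns indexed by $\mathcal F$ and the integer on the right is regarded as an element of $K$. In particular, this applies to every spectral idempotent of $A$ whose matrix entries lie in $O$ (every such idempotent commutes with $T$).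
   Context: The permutation matrix $T$ of $x$ is defined by $Te_u=e_{x(u)}$ on the standard basis $(e_u)_{u\in V(\Delta)}$ of $O^{V(\Delta)}$, and $x$ acts on $O^{V(\Delta)}$ by $T$. $\operatorname{tr}(x\mid K\otimes_O L)$ is the trace of the $K$-linear endomorphism of $K\otimes_O L$ induced by $x$. A spectral idempotent of $A$ is the projection, over an extension field of $K$ containing the eigenvalues of $A$, onto one eigenspace of $A$ along the sum of the other eigenspaces. An empty matrix has rank $0$. *)

(* Defs.v *)
From HB Require Import structures.
From mathcomp Require Import all_boot all_order all_fingroup all_algebra.
From mathcomp Require Import boolp.

Set Implicit Arguments.
Unset Strict Implicit.
Unset Printing Implicit Defensive.

Import Order.TTheory GRing.Theory Num.Theory.
Local Open Scope ring_scope.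

Notation "x %:F" := (@FracField.tofrac _ x) : ring_scope.

(* The value of v at 0 (usually +oo) is junk and never used. *)
Definition discrete_valuation (K : fieldType) (v : K -> int) : Prop :=
  [/\ forall a b, a != 0 -> b != 0 -> v (a * b) = v a + v b,
      forall a b, a != 0 -> b != 0 -> a + b != 0 ->
        Num.min (v a) (v b) <= v (a + b)
    & forall n : int, exists2 a, a != 0 & v a = n].

Definition valuation_ring (O : idomainType) (v : {fraction O} -> int) : Prop :=
  forall a : {fraction O}, (exists c : O, a = c%:F) <-> (a = 0 \/ 0 <= v a).

(* a - b lies in the N-th power of the maximal ideal *)
Definition adic_close (O : idomainType) (v : {fraction O} -> int)
    (N : nat) (a b : O) : Prop :=
  a = b \/ N%:Z <= v (a - b)%:F.

Definition adically_complete (O : idomainType) (v : {fraction O} -> int) : Prop :=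
  forall s : nat -> O,
    (forall N, exists M, forall i j, (M <= i)%N -> (M <= j)%N ->
       adic_close v N (s i) (s j)) ->
    exists l : O, forall N, exists M, forall i, (M <= i)%N ->
       adic_close v N (s i) l.

Definition complete_dvr (O : idomainType) : Prop :=
  exists v : {fraction O} -> int,
    [/\ discrete_valuation v, valuation_ring v & adically_complete v].

(* kappa = O / m via pi: the maximal ideal m of a local ring consists of the
   non-units. *)
Definition residue_map (O : idomainType) (kappa : fieldType)
    (pi : {rmorphism O -> kappa}) : Prop :=
  (forall y : kappa, exists a : O, pi a = y) /\
  (forall a : O, pi a = 0 <-> a \isn't a GRing.unit).

Definition bilinear_map (O : idomainType) (M N : lmodType O)
    (b : {fraction O} -> M -> N) : Prop :=
  (forall k (c : O) m m', b k (c *: m + m') = c *: b k m + b k m') /\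
  (forall (c : O) k k' m, b (c%:F * k + k') m = c *: b k m + b k' m).

(* W, with t k m in the role of k \otimes m, is the K-vector space
   K \otimes_O M, where K = {fraction O}: t is the universal O-bilinear map
   on K x M, and K acts by a *: (k \otimes m) = (a * k) \otimes m. *)
Definition is_scalar_extension (O : idomainType) (M : lmodType O)
    (W : lmodType {fraction O}) (t : {fraction O} -> M -> W) : Prop :=
  [/\ forall k (c : O) m m', t k (c *: m + m') = c%:F *: t k m + t k m',
      forall (c : O) k k' m, t (c%:F * k + k') m = c%:F *: t k m + t k' m,
      forall a k m, a *: t k m = t (a * k) m
    & forall (N : lmodType O) (b : {fraction O} -> M -> N), bilinear_map b ->
        let factors (h : W -> N) :=
          (forall (c : O) w w', h (c%:F *: w + w') = c *: h w + h w') /\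
          (forall k m, h (t k m) = b k m) in
        (exists h, factors h) /\
        (forall h h', factors h -> factors h' -> h =1 h')].

Definition lfun_trace (K : fieldType) (W : vectType K) (phi : 'End(W)) : K :=
  \tr (passmx.mxof (vbasis {:W}) (vbasis {:W}) phi).

Section ImageModule.
Variables (O : idomainType) (n : nat) (E : 'M[O]_n).

Definition mximage : {pred 'cV[O]_n} := [pred v | `[< exists w, v = E *m w >]].

Fact mximage_submod : submod_closed mximage.
Proof.
split=> [|a u v /asboolP[w ->] /asboolP[w' ->]]; apply/asboolP.
  by exists 0; rewrite mulmx0.
by exists (a *: w + w'); rewrite mulmxDr scalemxAr.
Qed.

HB.instance Definition _ :=
  GRing.isSubmodClosed.Build O 'cV[O]_n mximage mximage_submod.

Record image_module := ImageModule {
  image_val :> 'cV[O]_n;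
  _ : image_val \in mximage }.

HB.instance Definition _ := [isSub for image_val].
HB.instance Definition _ := [Choice of image_module by <:].
HB.instance Definition _ := [SubChoice_isSubLmodule of image_module by <:].

End ImageModule.

(* phi is the endomorphism of K \otimes_O L, L = E O^n, induced by the action
   of T on L. *)
Definition induced_endo (O : idomainType) (n : nat) (E T : 'M[O]_n)
    (W : vectType {fraction O}) (t : {fraction O} -> image_module E -> W)
    (phi : 'End(W)) : Prop :=
  forall k (l l' : image_module E),
    image_val l' = T *m image_val l -> phi (t k l) = t k l'.

Definition vmx (R : Type) (V : finType) (f : V -> V -> R) : 'M[R]_#|V| :=
  \matrix_(i, j) f (enum_val i) (enum_val j).

Definition principal_submx (R : Type) (V : finType) (S : {set V})
    (M : 'M[R]_#|V|) : 'M[R]_#|S| :=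
  \matrix_(i, j) M (enum_rank (enum_val i)) (enum_rank (enum_val j)).

Definition adjmx (R : nzRingType) (V : finType) (e : rel V) : 'M[R]_#|V| :=
  vmx (fun u v => (e u v)%:R).

(* Acting on columns, permutation_mx x sends e_v to e_(x v). *)
Definition permutation_mx (R : nzRingType) (V : finType) (x : {perm V}) :
    'M[R]_#|V| :=
  vmx (fun u v => (u == x v)%:R).

Definition graph_aut (V : finType) (e : rel V) (x : {perm V}) : Prop :=
  forall u v, e (x u) (x v) = e u v.

Definition fixed_vertices (V : finType) (x : {perm V}) : {set V} :=
  [set v | x v == v].

(* s lists all eigenvalues of A, theta is one of them, and P, acting on
   columns, is the projection onto the theta-eigenspace along the sum of the
   other ones. MathComp's row spaces describe column vectors after
   transposition: P^T is the column space of P, kermx P^T its kernel. *)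
Definition spectral_idempotent (F : fieldType) (n : nat) (A : 'M[F]_n)
    (P : 'M[F]_n) : Prop :=
  exists (s : seq F) (theta : F),
    [/\ char_poly A = \prod_(a <- s) ('X - a%:P), theta \in s,
        P *m P = P, (P^T :=: eigenspace A^T theta)%MS
      & (kermx P^T :=: \sum_(a <- s | a != theta) eigenspace A^T a)%MS].

Definition trace_rank_formula (O : idomainType) (kappa : fieldType)
    (pi : {rmorphism O -> kappa}) (V : finType) (x : {perm V})
    (E : 'M[O]_#|V|) : Prop :=
  let T := permutation_mx O x in
  (forall (W : vectType {fraction O})
          (t : {fraction O} -> image_module E -> W) (phi : 'End(W)),
     is_scalar_extension t -> induced_endo T t phi ->
     lfun_trace phi = (\tr (T *m E))%:F) /\
  (\tr (T *m E))%:F =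
    (\rank (map_mx pi (principal_submx (fixed_vertices x) E)))%:R
      :> {fraction O}.

(* W, t and phi as in trace_rank_formula exist. *)
Lemma scalar_extension_exists (O : idomainType) (n : nat) (E T : 'M[O]_n)
    (Eidem : E *m E = E) (ETC : E *m T = T *m E) :
  exists (W : vectType {fraction O})
         (t : {fraction O} -> image_module E -> W) (phi : 'End(W)),
    is_scalar_extension t /\ induced_endo T t phi.
Proof.
pose K := {fraction O}.
pose EK : 'M[K]_n := map_mx (@FracField.tofrac O) E.
pose TK : 'M[K]_n := map_mx (@FracField.tofrac O) T.
have EKidem : EK *m EK = EK by rewrite -map_mxM Eidem.
have EKTC : EK *m TK = TK *m EK by rewrite -!map_mxM ETC.
pose fE := linfun (mulmx EK : 'cV[K]_n -> 'cV[K]_n).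
pose fT := linfun (mulmx TK : 'cV[K]_n -> 'cV[K]_n).
pose U := limg fE.
have UP (w : 'cV[K]_n) : reflect (EK *m w = w) (w \in U).
  apply: (iffP idP) => [/memv_imgP[y _ ->]|<-].
    by rewrite lfunE /= mulmxA EKidem.
  by apply/memv_imgP; exists w; rewrite ?memvf ?lfunE.
have LP (l : image_module E) : E *m image_val l = image_val l.
  case: l => l /= /asboolP[w ->]; by rewrite mulmxA Eidem.
pose emb (l : image_module E) := map_mx (@FracField.tofrac O) (image_val l).
have embU k l : k *: emb l \in U.
  by apply/UP; rewrite -scalemxAr -map_mxM LP.
pose t (k : K) (l : image_module E) : subvs_of U := vsproj U (k *: emb l).
have valt k l : vsval (t k l) = k *: emb l by rewrite vsprojK.
have valD (a : K) (w w' : subvs_of U) :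
    vsval (a *: w + w') = a *: vsval w + vsval w' by [].
have vinj (w w' : subvs_of U) : vsval w = vsval w' -> w = w'.
  exact: val_inj.
have embD (c : O) l l' : emb (c *: l + l') = c%:F *: emb l + emb l'.
  by rewrite /emb /= raddfD /= map_mxZ.
have gP u : E *m delta_mx u 0 \in mximage E.
  by apply/asboolP; exists (delta_mx u 0).
pose g u := ImageModule (gP u).
have gE (a : 'I_n -> O) (l : image_module E) :
    (forall u, a u = image_val l u 0) -> l = \sum_u a u *: g u.
  move=> al; apply: val_inj; rewrite raddf_sum -[LHS]LP /=.
  rewrite [in LHS](matrix_sum_delta (image_val l)) mulmx_sumr.
  apply: eq_bigr => u _; by rewrite big_ord1 -scalemxAr -al.
have tgE (w : subvs_of U) : w = \sum_u t (vsval w u 0) (g u).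
  apply: val_inj; rewrite raddf_sum /=.
  have /UP {1}<- := subvsP w.
  rewrite [X in EK *m X](matrix_sum_delta (vsval w)) mulmx_sumr.
  apply: eq_bigr => u _; rewrite valt big_ord1 -scalemxAr; congr (_ *: _).
  by rewrite /emb /= map_mxM map_delta_mx.
pose phi := linfun (vsproj U \o fT \o vsval : subvs_of U -> subvs_of U).
exists (subvs_of U), t, phi; split; last first.
  move=> k l l' El'; apply: val_inj; rewrite lfunE /= !valt lfunE /=.
  rewrite /emb El' map_mxM -scalemxAr vsprojK //.
  by apply/UP; rewrite -scalemxAr -!map_mxM mulmxA ETC -mulmxA LP.
split.
- by move=> k c l l'; apply: vinj; rewrite valD !valt embD scalerDr !scalerA mulrC.
- by move=> c k k' l; apply: vinj; rewrite valD !valt scalerDl scalerA.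
- move=> a k l; apply: vinj.
  by rewrite -[LHS]/(a *: vsval (t k l)) !valt scalerA.
move=> N b [b1 b2] factors.
have b0r k : b k 0 = 0.
  by have := b1 k (-1) 0 0; rewrite scaler0 addr0 scaleN1r addNr.
have bZ k c m : b k (c *: m) = c *: b k m.
  by have := b1 k c m 0; rewrite b0r !addr0.
have b0l m : b 0 m = 0.
  by have := b2 (-1) 0 0 m; rewrite mulr0 addr0 scaleN1r addNr.
have bZl c k m : b (c%:F * k) m = c *: b k m.
  by have := b2 c k 0 m; rewrite b0l !addr0.
have bD k m m' : b k (m + m') = b k m + b k m'.
  by have := b1 k 1 m m'; rewrite !scale1r.
split.
  exists (fun w : subvs_of U => \sum_u b (vsval w u 0) (g u)); split.
    move=> c w w'; rewrite scaler_sumr -big_split; apply: eq_bigr => u _ /=.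
    by rewrite !mxE b2.
  move=> k l; rewrite [in RHS](gE (fun u => image_val l u 0) l) //.
  rewrite (big_morph _ (bD k) (b0r k)); apply: eq_bigr => u _.
  by rewrite valt !mxE mulrC bZl bZ.
move=> h h' [hD ht] [hD' ht'] w.
have additive_of (f : subvs_of U -> N) :
    (forall (c : O) w w', f (c%:F *: w + w') = c *: f w + f w') ->
    f 0 = 0 /\ {morph f : w w' / w + w'}.
  move=> fD; split=> [|u v].
    by have := fD (-1) 0 0; rewrite scaler0 addr0 scaleN1r addNr.
  by have := fD 1 u v; rewrite rmorph1 !scale1r.
have [h0 hM] := additive_of h hD; have [h0' hM'] := additive_of h' hD'.
rewrite (tgE w) (big_morph _ hM h0) (big_morph _ hM' h0').
by apply: eq_bigr => u _; rewrite ht ht'.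
Qed.

(* Main.v *)
Require Import Defs.
From mathcomp Require Import all_boot all_order all_fingroup all_algebra.
From HB Require Import structures.
From mathcomp Require Import cyclic boolp generic_quotient.

Set Implicit Arguments.
Unset Strict Implicit.
Unset Printing Implicit Defensive.

Import Order.TTheory GRing.Theory Num.Theory.
Local Open Scope ring_scope.

(** The image L of E is a direct summand of a permutation module of the group
    C of order p generated by x.  Over a local ring whose residue field kappa
    has characteristic p, such a summand is a direct sum of trivial modules O
    and free modules O[C]: x has trace 1 on the former and trace 0 on the
    latter, so the trace of x on L counts the trivial summands.  The same
    number is the rank of E[F] mod m, because M |-> M[F] is multiplicative in
    characteristic p on the matrices that commute with T (the Brauer
    homomorphism, [brauerM]): it sends the idempotent E to an idempotent of
    that rank, and it kills the free summands.

    The decomposition is made by explicit splittings.  If a : O^k -> L and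
    b : L -> O^k are equivariant and b a is invertible, then
    E - a (b a)^-1 b is again an equivariant idempotent ([split_off]), and
    the trace drops by the trace of the generator on O^k.  As O is local, it
    is enough that b a is invertible over kappa.

    The trivial summands are split off at once in [trace_eq_rank]: a rank
    factorization of the idempotent E[F] mod m lifts to such a pair with
    b a = 1 mod m.  What remains has E[F] = 0 mod m, and [trace_eq0] shows by
    induction on the rank of E mod m that its trace is 0.  The point is that a
    nonzero summand of this kind has a vector v whose norm (the sum of its
    translates) is nonzero over kappa ([brauer_norm_neq0]).  A linear form that
    is nonzero on this norm gives an equivariant b from L to O[C], while the
    translates of v give a from O[C] to L; their composite b a is a unit of
    the local ring O[C], since its augmentation is nonzero
    ([ordS_comm_unitmx]).  So a copy of O[C] splits off.

    The trace on the scalar extension is computed from its universal property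
    ([induced_endo_trace]): every w in it is the sum of the
    chi_u(w) (1 (x) E e_u) for linear forms chi_u, the coordinates of the map to
    K^V induced by the inclusion of L.  Finally, x preserves every eigenspace
    of A, hence the image and the kernel of a spectral idempotent, which
    therefore commutes with T. *)

(** * Linear algebra in characteristic p *)

Lemma col_mulmx (R : pzSemiRingType) m n q (A : 'M[R]_(m, n))
    (B : 'M[R]_(n, q)) k :
  col k (A *m B) = A *m col k B.
Proof.
by apply/colP=> i; rewrite !mxE; apply: eq_bigr => j _; rewrite mxE.
Qed.

Lemma map_mxX (R R' : comNzRingType) (h : {rmorphism R -> R'}) n
    (A : 'M[R]_n) k :
  map_mx h (A ^+ k) = map_mx h A ^+ k.
Proof. by elim: k => [|k IH]; rewrite ?map_mx1 // !exprS [LHS]map_mxM IH. Qed.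

Lemma map_invmx_unit (R R' : comUnitRingType) (h : {rmorphism R -> R'}) n
    (A : 'M[R]_n) :
  A \in unitmx -> map_mx h (invmx A) = invmx (map_mx h A).
Proof.
move=> Au; have Au' : map_mx h A \in unitmx.
  by rewrite unitmxE det_map_mx rmorph_unit.
by rewrite -[LHS](mulmxK Au') -map_mxM mulVmx // map_mx1 mul1mx.
Qed.

Lemma fix_exprl (R : pzSemiRingType) n m (T : 'M[R]_n) (w : 'M_(n, m)) k :
  T *m w = w -> T ^+ k *m w = w.
Proof.
by move=> Tw; elim: k => [|k IH]; rewrite ?mul1mx // exprSr -mulmxA Tw.
Qed.

Lemma fix_exprr (R : pzSemiRingType) n m (T : 'M[R]_n) (w : 'M_(m, n)) k :
  w *m T = w -> w *m T ^+ k = w.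
Proof.
by move=> Tw; elim: k => [|k IH]; rewrite ?mulmx1 // exprS mulmxA Tw.
Qed.

Lemma norm_fixed (R : comNzRingType) p n (T : 'M[R]_n) :
    (0 < p)%N -> T ^+ p = 1 ->
  T *m (\sum_(k < p) T ^+ k) = \sum_(k < p) T ^+ k.
Proof.
move=> p_gt0 Tp; rewrite mulmx_sumr -(big_mkord xpredT (fun k => T ^+ k)).
rewrite (eq_bigr (fun k : 'I_p => T ^+ k.+1)) => [|k _]; last by rewrite exprS.
rewrite -(big_mkord xpredT (fun k => T ^+ k.+1)) -(prednK p_gt0).
by rewrite [RHS]big_nat_recl // [LHS]big_nat_recr //= prednK // Tp expr0 addrC.
Qed.

Lemma mx_pFrobeniusB1 (F : fieldType) p n (T : 'M[F]_n) :
  p \in [pchar F] -> (T - 1) ^+ p = T ^+ p - 1.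
Proof.
case: n T => [|n] T charFp; first by rewrite [LHS]flatmx0 [RHS]flatmx0.
have charMp : p \in [pchar 'M[F]_n.+1] by rewrite pchar_lalg.
have /(pFrobenius_autB_comm charMp) : GRing.comm T 1 by exact: commr1.
by rewrite !pFrobenius_autE expr1n.
Qed.

(** A group of order p that acts on a nonzero space in characteristic p has a
    nonzero fixed vector, since T - 1 is nilpotent.  The space is the kernel
    of M, and its vectors are taken m at a time, as the columns of w. *)
Lemma pchar_fixed_vector (F : fieldType) p n m (T M : 'M[F]_n)
    (w : 'M[F]_(n, m)) :
    p \in [pchar F] -> T ^+ p = 1 -> M *m T = T *m M ->
    w != 0 -> M *m w = 0 ->
  exists w' : 'M[F]_(n, m), [/\ w' != 0, M *m w' = 0 & T *m w' = w'].
Proof.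
move=> charFp Tp MT w0 Mw.
have nil : exists k, (T - 1) ^+ k *m w == 0.
  by exists p; rewrite mx_pFrobeniusB1 // Tp subrr mul0mx.
case: (ex_minnP nil) => -[|k] /eqP.
  by rewrite mul1mx => wE; rewrite wE eqxx in w0.
rewrite exprS -mulmxA mulmxBl mul1mx => /eqP; rewrite subr_eq0.
move=> /eqP fixw' min.
exists ((T - 1) ^+ k *m w); split=> //.
  by apply/negP => /min; rewrite ltnn.
have /commrX-/(_ k) cMk : GRing.comm M (T - 1).
  by apply: commrB => //; exact: commr1.
by rewrite mulmxA [M *m _]cMk -mulmxA Mw mulmx0.
Qed.

Lemma idempotent_rank_factor (F : fieldType) n (M : 'M[F]_n) :
  M *m M = M -> row_base M *m col_base M = 1%:M.
Proof.
move=> MM; apply: (row_free_inj (row_base_free M)).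
apply: (row_full_inj (col_base_full M)).
by rewrite mul1mx -mulmxA mulmx_base mulmxA mulmx_base MM.
Qed.

(** * Splitting a summand off an idempotent *)

Section SplitOff.
Variables (R : comUnitRingType) (n k : nat) (E T : 'M[R]_n) (S : 'M[R]_k).
Variables (a : 'M[R]_(n, k)) (b : 'M[R]_(k, n)).
Hypotheses (EE : E *m E = E) (Ea : E *m a = a) (bE : b *m E = b).

(** The matrix a (b a)^-1 b is the projection onto the image of a along the
    kernel of b. *)
Definition split_off := E - a *m invmx (b *m a) *m b.

Lemma split_offEl : E *m split_off = split_off.
Proof. by rewrite mulmxBr EE !mulmxA Ea. Qed.

Lemma split_offEr : split_off *m E = split_off.
Proof. by rewrite mulmxBl EE -[_ *m b *m E]mulmxA bE. Qed.

Hypothesis ba_unit : b *m a \in unitmx.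

Lemma split_off_killl : split_off *m a = 0.
Proof. by rewrite mulmxBl Ea -!mulmxA mulVmx // mulmx1 subrr. Qed.

Lemma split_off_idem : split_off *m split_off = split_off.
Proof.
by rewrite {2}/split_off mulmxBr split_offEr !mulmxA split_off_killl
           !mul0mx subr0.
Qed.

Hypotheses (ET : E *m T = T *m E).
Hypotheses (Ta : T *m a = a *m S) (bT : b *m T = S *m b).

Lemma split_off_comm : split_off *m T = T *m split_off.
Proof.
have SG : S *m (b *m a) = (b *m a) *m S by rewrite mulmxA -bT -!mulmxA Ta.
have SV : invmx (b *m a) *m S = S *m invmx (b *m a).
  by apply: (canRL (mulmxK ba_unit)); rewrite -mulmxA SG mulKmx.
rewrite mulmxBl mulmxBr ET -!mulmxA bT; congr (_ - _).
by rewrite [invmx _ *m _]mulmxA SV !mulmxA Ta.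
Qed.

Lemma split_off_trace : \tr (T *m split_off) = \tr (T *m E) - \tr S.
Proof.
rewrite mulmxBr raddfB /= !mulmxA Ta; congr (_ - _).
by rewrite -!mulmxA mxtrace_mulC -!mulmxA mulVmx // mulmx1.
Qed.

End SplitOff.

Lemma map_split_off (R R' : comUnitRingType) (h : {rmorphism R -> R'}) n k
    (E : 'M[R]_n) (a : 'M_(n, k)) (b : 'M_(k, n)) :
    b *m a \in unitmx ->
  map_mx h (split_off E a b) =
    split_off (map_mx h E) (map_mx h a) (map_mx h b).
Proof. by move=> ba; rewrite map_mxB !map_mxM map_invmx_unit // map_mxM. Qed.

(** The row space of the new idempotent lies in that of E, and it is smaller
    because the new idempotent kills a while E fixes it. *)
Lemma rank_split_off_lt (F : fieldType) n k (E : 'M[F]_n)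
    (a : 'M_(n, k)) (b : 'M_(k, n)) :
    E *m E = E -> E *m a = a -> b *m E = b -> b *m a \in unitmx -> (0 < k)%N ->
  (\rank (split_off E a b) < \rank E)%N.
Proof.
move=> EE Ea bE ba k0; apply: rank_ltmx.
rewrite ltmxE -{1}(split_offEr a EE bE) submxMl /=.
apply/negP => /submxP[X EX].
have a0 : a = 0 by rewrite -Ea EX -mulmxA split_off_killl // mulmx0.
move: ba; rewrite a0 mulmx0 unitmxE unitfE.
by case: (k) k0 => // m _; rewrite det0 eqxx.
Qed.

(** * Matrices of maps and the regular module of a cyclic group *)

Definition fun_mx (R : pzSemiRingType) m n (g : 'I_n -> 'I_m) : 'M[R]_(m, n) :=
  \matrix_(i, j) (i == g j)%:R.

Lemma mul_fun_mx (R : pzSemiRingType) m n q (g : 'I_n -> 'I_m)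
    (A : 'M[R]_(q, m)) i j :
  (A *m fun_mx R g) i j = A i (g j).
Proof.
rewrite mxE (bigD1 (g j)) //= mxE eqxx mulr1 big1 ?addr0 // => k /negPf kN.
by rewrite mxE kN mulr0.
Qed.

Lemma fun_mx_mul (R : pzSemiRingType) m n q (g : 'I_n -> 'I_m)
    (A : 'M[R]_(n, q)) i j :
  injective g -> (fun_mx R g *m A) (g i) j = A i j.
Proof.
move=> g_inj; rewrite mxE (bigD1 i) //= mxE eqxx mul1r.
rewrite big1 ?addr0 // => k /negPf kN.
by rewrite mxE inj_eq // eq_sym kN mul0r.
Qed.

Lemma tr_fun_mx_mul (R : pzSemiRingType) m n q (g : 'I_n -> 'I_m)
    (A : 'M[R]_(m, q)) i j :
  ((fun_mx R g)^T *m A) i j = A (g i) j.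
Proof.
rewrite mxE (bigD1 (g i)) //= !mxE eqxx mul1r big1 ?addr0 // => k /negPf kN.
by rewrite !mxE kN mul0r.
Qed.

Lemma fun_mxX (R : pzSemiRingType) n (g : 'I_n -> 'I_n) k :
  fun_mx R g ^+ k = fun_mx R (iter k g).
Proof.
elim: k => [|k IH]; first by apply/matrixP=> i j; rewrite !mxE.
by rewrite exprSr IH; apply/matrixP=> i j; rewrite [LHS]mul_fun_mx !mxE iterSr.
Qed.

Lemma iter_ordS p k (j : 'I_p) : iter k (@ordS p) j = ((j + k) %% p)%N :> nat.
Proof.
elim: k => [|k IH] /=; first by rewrite addn0 modn_small.
by rewrite IH -addn1 modnDml addn1 addnS.
Qed.

Lemma ordS_mxXp (R : pzSemiRingType) p : fun_mx R (@ordS p) ^+ p = 1.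
Proof.
rewrite fun_mxX; apply/matrixP=> i j; rewrite !mxE -!val_eqE /= iter_ordS.
by rewrite modnDr modn_small.
Qed.

Lemma ordS_mx_trace (R : pzSemiRingType) p :
  (1 < p)%N -> \tr (fun_mx R (@ordS p)) = 0.
Proof.
move=> p1; rewrite /mxtrace big1 // => i _; rewrite mxE -val_eqE /=.
case: (ltnP i.+1 p) => [lt|ge]; first by rewrite modn_small // ltn_eqF.
have -> : i.+1 = p by apply/eqP; rewrite eqn_leq ge ltn_ord.
by rewrite modnn; case: (nat_of_ord i) ge => [|k _]; rewrite // leqNgt p1.
Qed.

Lemma ordS_mx_fixed (R : pzSemiRingType) p m (w : 'M[R]_(p, m)) i i' j :
  fun_mx R (@ordS p) *m w = w -> w i j = w i' j.
Proof.
move=> Sw.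
have wS k u : w (iter k (@ordS p) u) j = w u j.
  elim: k => [//|k IH]; rewrite iterS -{1}Sw fun_mx_mul //; exact: ordS_inj.
rewrite -(wS (p - i + i')%N i); congr (w _ j); apply: val_inj.
by rewrite /= iter_ordS addnA subnKC 1?ltnW // modnDl modn_small.
Qed.

(** The matrices that commute with the cyclic shift are the elements of the
    group algebra of the cyclic group of order p, and the common row sum c is
    the augmentation: an element outside the augmentation ideal is a unit.
    Otherwise the kernel of G would contain a vector fixed by the shift, that
    is, a constant one, and G multiplies such a vector by c. *)
Lemma ordS_comm_unitmx (F : fieldType) p (G : 'M[F]_p) c :
    p \in [pchar F] -> G *m fun_mx F (@ordS p) = fun_mx F (@ordS p) *m G ->
    c != 0 -> (forall i, \sum_k G i k = c) ->
  G \in unitmx.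
Proof.
move=> charFp GS c0 Gc; rewrite -row_full_unit -cokermx_eq0.
apply: contraT => kG; have [w [w0 Gw Sw]] :=
  pchar_fixed_vector charFp (ordS_mxXp F p) GS kG (mulmx_coker G).
case/eqP: w0; apply/matrixP=> i j; rewrite mxE.
have /matrixP/(_ i j) := Gw; rewrite !mxE.
rewrite (eq_bigr (fun k => G i k * w i j)) => [|k _]; last first.
  by rewrite (ordS_mx_fixed k i j Sw).
by rewrite -mulr_suml Gc => /eqP; rewrite mulf_eq0 (negPf c0) => /eqP.
Qed.

(** * The Brauer homomorphism *)

(** What the proof uses of a permutation matrix T of order p.  The columns of
    J are the basis vectors fixed by T, so that J^T M J is the principal
    submatrix of M on the fixed points.  D is the diagonal indicator matrix of
    a set of representatives of the regular orbits; the last equation says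
    that the translates of D, where T^(p-1) is the inverse of T, cover every
    point that is not fixed exactly once. *)
Definition fixed_point_data (R : comNzRingType) (p n f : nat) (T : 'M[R]_n)
    (J : 'M[R]_(n, f)) (D : 'M[R]_n) :=
  [/\ T ^+ p = 1, T *m J = J, J^T *m T = J^T
    & 1%:M - J *m J^T = \sum_(k < p) T ^+ k *m D *m (T ^+ p.-1) ^+ k].

Lemma map_fixed_point_data (R R' : comNzRingType) (h : {rmorphism R -> R'})
    p n f (T : 'M[R]_n) (J : 'M[R]_(n, f)) (D : 'M[R]_n) :
    fixed_point_data p T J D ->
  fixed_point_data p (map_mx h T) (map_mx h J) (map_mx h D).
Proof.
case=> Tp TJ JT defD.
rewrite /fixed_point_data -map_mxX Tp map_mx1 -map_mxM TJ map_trmx -map_mxM JT.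
split=> //; rewrite -map_mxM -(map_mx1 h) -map_mxB defD raddf_sum.
by apply: eq_bigr => k _; rewrite /= !map_mxM !map_mxX.
Qed.

Section Brauer.
Variables (F : fieldType) (p n f : nat) (T : 'M[F]_n).
Variables (J : 'M[F]_(n, f)) (D : 'M[F]_n).
Hypotheses (charFp : p \in [pchar F]) (TJD : fixed_point_data p T J D).

(** An entry of (A B)[F] is a sum over all vertices v of products that are
    constant on the orbits of v, so that each regular orbit contributes a
    multiple of p and only the fixed points remain. *)
Lemma brauerM (A B : 'M[F]_n) :
    A *m T = T *m A -> B *m T = T *m B ->
  J^T *m (A *m B) *m J = (J^T *m A *m J) *m (J^T *m B *m J).
Proof.
move=> AT BT; have [_ TJ JT defD] := TJD.
apply/eqP; rewrite -subr_eq0; apply/eqP.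
have -> : J^T *m (A *m B) *m J - (J^T *m A *m J) *m (J^T *m B *m J)
    = J^T *m A *m (1%:M - J *m J^T) *m (B *m J).
  by rewrite mulmxBr mulmx1 mulmxBl !mulmxA.
rewrite defD mulmx_sumr mulmx_suml.
rewrite (eq_bigr (fun=> J^T *m A *m D *m B *m J)) => [|k _].
  by rewrite sumr_const card_ord -scaler_nat (pcharf0 charFp) scale0r.
have /commrX cA : GRing.comm A T by [].
have /commrX-/(_ p.-1)/commrX cB : GRing.comm B T by [].
rewrite -exprM !mulmxA -[J^T *m A *m _]mulmxA [A *m _]cA mulmxA fix_exprr //.
rewrite -!mulmxA [T ^+ _ *m (B *m J)]mulmxA; congr (_ *m (_ *m (_ *m _))).
by rewrite exprM -[_ *m B]cB -exprM -mulmxA fix_exprl.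
Qed.

(** Let N be the norm and w a nonzero fixed vector in the image of E.  Being
    constant on the orbits, w is the sum of a vector J y supported on the
    fixed points, where y = J^T w, and of a norm N z.  If E N E = E N were 0,
    then w = E w = E J y, whence y = J^T w = E[F] y = 0 and w = 0. *)
Lemma brauer_norm_neq0 (E : 'M[F]_n) :
    E *m E = E -> E *m T = T *m E -> E != 0 -> J^T *m E *m J = 0 ->
  E *m (\sum_(k < p) T ^+ k) *m E != 0.
Proof.
move=> EE ET E0 EJ; apply/eqP => nuE; have [Tp TJ JT defD] := TJD.
have [] := @pchar_fixed_vector _ p _ _ T (1 - E) E charFp Tp _ E0.
- by rewrite mulmxBl mulmxBr ET mul1mx mulmx1.
- by rewrite mulmxBl EE mul1mx subrr.
move=> w [w0 /eqP Ew Tw]; move: Ew.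
rewrite mulmxBl mul1mx subr_eq0 => /eqP Ew.
have wE : w = J *m (J^T *m w) + (\sum_(k < p) T ^+ k) *m (D *m w).
  rewrite -[LHS](subrK (J *m (J^T *m w))) addrC; congr (_ + _).
  rewrite [J *m _]mulmxA -[X in X - _]mul1mx -mulmxBl defD !mulmx_suml.
  by apply: eq_bigr => k _; rewrite -!mulmxA -exprM (fix_exprl _ Tw).
have cEN : E *m (\sum_(k < p) T ^+ k) = (\sum_(k < p) T ^+ k) *m E.
  by apply: commr_sum => k _; exact: commrX.
have EN : E *m (\sum_(k < p) T ^+ k) = 0 by rewrite -EE -mulmxA cEN mulmxA.
have EwJ : w = E *m J *m (J^T *m w).
  rewrite [LHS]Ew [X in X = _](congr1 (mulmx E) wE) mulmxDr !mulmxA EN.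
  by rewrite !mul0mx addr0.
have Jw : J^T *m w = 0 by rewrite EwJ !mulmxA EJ !mul0mx.
by rewrite EwJ Jw mulmx0 eqxx in w0.
Qed.

End Brauer.

(** * Equivariant idempotents over a local ring *)

Section Local.
Variables (O : comUnitRingType) (kappa : fieldType).
Variable pi : {rmorphism O -> kappa}.
Hypothesis pi_surj : forall y : kappa, exists a : O, pi a = y.
Hypothesis pi_unit : forall a : O, pi a != 0 -> a \is a GRing.unit.

Local Notation "M ^pi" := (map_mx pi M) (at level 2, format "M ^pi").

Lemma unitmx_residue n (M : 'M[O]_n) : M^pi \in unitmx -> M \in unitmx.
Proof. by rewrite !unitmxE det_map_mx unitfE => /pi_unit. Qed.

Lemma lift_residue_mx m n (M : 'M[kappa]_(m, n)) :
  exists M' : 'M[O]_(m, n), M'^pi = M.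
Proof.
have /fin_all_exists[g gM] (ij : 'I_m * 'I_n) : exists a, pi a = M ij.1 ij.2.
  exact: pi_surj.
by exists (\matrix_(i, j) g (i, j)); apply/matrixP=> i j; rewrite !mxE gM.
Qed.

Variables (p n f : nat) (T : 'M[O]_n) (J : 'M[O]_(n, f)) (D : 'M[O]_n).
Hypotheses (p_prime : prime p) (charkp : p \in [pchar kappa]).
Hypothesis TJD : fixed_point_data p T J D.

Let Tp : T ^+ p = 1. Proof. by case: TJD. Qed.
Let TJ : T *m J = J. Proof. by case: TJD. Qed.
Let JT : J^T *m T = J^T. Proof. by case: TJD. Qed.
Let p_gt0 : (0 < p)%N. Proof. exact: prime_gt0. Qed.
Let TJDk : fixed_point_data p T^pi J^pi D^pi.
Proof. exact: map_fixed_point_data. Qed.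

(** If E mod m is nonzero but E[F] mod m is zero, a free module of rank 1 over
    the group algebra splits off.  Let the entry (i, j) of E N E be nonzero
    over kappa, where N is the norm.  The columns of a are the translates
    T^k E e_j of a vector of the image, and the rows of b are the translates
    e_i^T E T^-k of a linear form.  The entry (u, k) of b a depends only on
    k - u mod p, and all row sums of b a are equal to the chosen entry. *)
Lemma split_off_regular (E : 'M[O]_n) :
    E *m E = E -> E *m T = T *m E -> E^pi != 0 ->
    J^pi^T *m E^pi *m J^pi = 0 ->
  exists E' : 'M[O]_n,
    [/\ E' *m E' = E', E' *m T = T *m E', J^pi^T *m E'^pi *m J^pi = 0,
        (\rank E'^pi < \rank E^pi)%N & \tr (T *m E') = \tr (T *m E)].
Proof.
move=> EE ET E0 EJ.
have EEk : E^pi *m E^pi = E^pi by rewrite -map_mxM EE.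
have ETk : E^pi *m T^pi = T^pi *m E^pi by rewrite -!map_mxM ET.
have := brauer_norm_neq0 charkp TJDk EEk ETk E0 EJ.
have -> : \sum_(k < p) T^pi ^+ k = (\sum_(k < p) T ^+ k)^pi.
  by rewrite raddf_sum; apply: eq_bigr => k _; rewrite /= map_mxX.
rewrite -!map_mxM => /matrix0Pn[i [j]]; rewrite mxE => c0.
(* U is the inverse of T *)
pose U := T ^+ p.-1.
have UT : U *m T = 1 by rewrite -[_ *m _]exprSr prednK.
have Up : U ^+ p = 1 by rewrite -exprM mulnC exprM Tp expr1n.
have cET k : E *m T ^+ k = T ^+ k *m E by apply: (@commrX _ E T).
have cEU k : E *m U ^+ k = U ^+ k *m E by rewrite -exprM cET.
pose a := \matrix_(u < n, k < p) (T ^+ k *m E) u j.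
pose b := \matrix_(k < p, v < n) (E *m U ^+ k) i v.
have aE k : col k a = T ^+ k *m col j E.
  by rewrite -col_mulmx; apply/colP=> u; rewrite !mxE.
have bE k : row k b = row i E *m U ^+ k.
  by rewrite -row_mul; apply/rowP=> u; rewrite !mxE.
have col_eq m (A B : 'M[O]_(m, p)) : (forall k, col k A = col k B) -> A = B.
  by move=> AB; apply/matrixP=> u k; have /colP/(_ u) := AB k; rewrite !mxE.
have Ea : E *m a = a.
  apply: col_eq => k; rewrite col_mulmx aE.
  by rewrite mulmxA cET -mulmxA -col_mulmx EE.
have bE' : b *m E = b.
  apply/row_matrixP => k; rewrite row_mul bE.
  by rewrite -mulmxA -cEU mulmxA -row_mul EE.
pose S := fun_mx O (@ordS p).
have Ta : T *m a = a *m S.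
  apply: col_eq => k; rewrite col_mulmx aE mulmxA.
  have -> : col k (a *m S) = col (ordS k) a.
    by apply/colP=> u; rewrite [LHS]mxE mul_fun_mx [RHS]mxE.
  by rewrite aE /= expr_mod // exprS.
have bT : b *m T = S *m b.
  apply/row_matrixP => k; rewrite -(ord_predK k) row_mul; set l := ord_pred k.
  have -> : row (ordS l) (S *m b) = row l b.
    apply/rowP=> u; rewrite ![row _ _ _ _]mxE fun_mx_mul //; exact: ordS_inj.
  by rewrite !bE /= expr_mod // exprSr -!mulmxA [_ *m T]UT mulmx1.
have SF : S^pi = fun_mx kappa (@ordS p).
  by apply/matrixP=> u v; rewrite !mxE rmorph_nat.
have bau : (b *m a)^pi \in unitmx.
  apply: (ordS_comm_unitmx charkp _ c0) => [|u].
    by rewrite -SF -!map_mxM -mulmxA -Ta mulmxA bT mulmxA.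
  rewrite (eq_bigr (fun k => pi ((b *m a) u k))) => [|k _]; last by rewrite mxE.
  rewrite -raddf_sum /=; congr (pi _).
  have -> : \sum_k (b *m a) u k = (row u b *m \sum_k col k a) 0 0.
    rewrite mulmx_sumr summxE; apply: eq_bigr => k _.
    by rewrite -row_mul -!col_mulmx !mxE.
  rewrite (eq_bigr _ (fun k _ => aE k)).
  rewrite -mulmx_suml bE -mulmxA [U ^+ u *m _]mulmxA.
  rewrite fix_exprl; first by rewrite mulmxA -!row_mul -col_mulmx 2![LHS]mxE.
  by rewrite -{1}(norm_fixed p_gt0 Tp) mulmxA UT mul1mx.
have bau' := unitmx_residue bau.
exists (split_off E a b).
have EE' := split_off_idem EE Ea bE' bau'.
have ET' := split_off_comm bau' ET Ta bT.
have Eak : E^pi *m a^pi = a^pi by rewrite -map_mxM Ea.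
have bEk : b^pi *m E^pi = b^pi by rewrite -map_mxM bE'.
split=> //.
- rewrite -(split_offEl b EE Ea) map_mxM (brauerM charkp TJDk) //.
    by rewrite EJ mul0mx.
  by rewrite -!map_mxM ET'.
- by rewrite map_split_off // rank_split_off_lt // -map_mxM.
- by rewrite (split_off_trace _ bau' Ta) ordS_mx_trace ?subr0 // prime_gt1.
Qed.

Lemma trace_eq0 (E : 'M[O]_n) :
    E *m E = E -> E *m T = T *m E -> J^pi^T *m E^pi *m J^pi = 0 ->
  \tr (T *m E) = 0.
Proof.
move: {2}(\rank _) (leqnn (\rank E^pi)) => r.
elim: r E => [|r IH] E rE EE ET EJ.
  (* an idempotent that is 0 mod m vanishes, as 1 - E is invertible *)
  have Ek : E^pi = 0 by apply/eqP; rewrite -mxrank_eq0 -leqn0.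
  have : 1%:M - E \in unitmx.
    by apply: unitmx_residue; rewrite map_mxB map_mx1 Ek subr0 unitmx1.
  move=> /mulKmx/(_ E); rewrite mulmxBl mul1mx EE subrr mulmx0 => <-.
  by rewrite mulmx0 mxtrace0.
have [Ek|Ek] := eqVneq E^pi 0; first by apply: IH; rewrite // Ek mxrank0.
have [E' [EE' ET' EJ' rE' <-]] := split_off_regular EE ET Ek EJ.
by apply: IH; rewrite // -ltnS (leq_trans rE').
Qed.

(** The idempotent M = E[F] mod m factors as P Q with Q P = 1.  With lifts of
    P and Q to O, the maps a = E J P and b = Q J^T E are equivariant for the
    trivial action on O^r, and b a = 1 mod m.  The remaining idempotent E'
    kills a, so that E'[F] P = 0 and E'[F] = E'[F] P Q = 0 mod m. *)
Lemma trace_eq_rank (E : 'M[O]_n) :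
    E *m E = E -> E *m T = T *m E ->
  \tr (T *m E) = (\rank (J^pi^T *m E^pi *m J^pi))%:R.
Proof.
move=> EE ET.
have EEk : E^pi *m E^pi = E^pi by rewrite -map_mxM EE.
have ETk : E^pi *m T^pi = T^pi *m E^pi by rewrite -!map_mxM ET.
set M := J^pi^T *m E^pi *m J^pi.
have MM : M *m M = M by rewrite -(brauerM charkp TJDk) // EEk.
have [P PE] := lift_residue_mx (col_base M).
have [Q QE] := lift_residue_mx (row_base M).
pose a := E *m J *m P; pose b := Q *m J^T *m E.
have Ea : E *m a = a by rewrite /a !mulmxA EE.
have bE : b *m E = b by rewrite /b -mulmxA EE.
have Ta : T *m a = a *m 1%:M by rewrite mulmx1 /a !mulmxA -ET -(mulmxA E) TJ.
have bT : b *m T = 1%:M *m b.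
  by rewrite mul1mx /b -mulmxA ET mulmxA -(mulmxA Q) JT.
have bak : (b *m a)^pi = 1%:M.
  rewrite /a /b -!mulmxA [E *m (E *m _)]mulmxA EE !map_mxM PE QE -map_trmx.
  rewrite [E^pi *m _]mulmxA [J^pi^T *m _]mulmxA [J^pi^T *m _]mulmxA -/M.
  have := congr1 (mulmx^~ (col_base M)) (mulmx_base M).
  rewrite /= -mulmxA idempotent_rank_factor // mulmx1 => <-.
  by rewrite idempotent_rank_factor.
have bau : b *m a \in unitmx by apply: unitmx_residue; rewrite bak unitmx1.
have E'k : (split_off E a b)^pi *m E^pi = (split_off E a b)^pi.
  by rewrite -map_mxM split_offEr.
have ET' := split_off_comm bau ET Ta bT.
have /eqP : \tr (T *m split_off E a b) = 0.
  apply: trace_eq0 => //; first exact: split_off_idem.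
  rewrite -E'k (brauerM charkp TJDk) //; last by rewrite -!map_mxM ET'.
  rewrite -/M; set N := J^pi^T *m _ *m J^pi.
  suff N0 : N *m col_base M = 0.
    have := congr1 (mulmx N) (mulmx_base M).
    by rewrite /= mulmxA N0 mul0mx => <-.
  have -> : N *m col_base M = J^pi^T *m (split_off E a b *m a)^pi.
    have apiE : a^pi = E^pi *m (J^pi *m col_base M).
      by rewrite !map_mxM PE mulmxA.
    by rewrite map_mxM apiE [_ *m (E^pi *m _)]mulmxA E'k !mulmxA.
  by rewrite split_off_killl // map_mx0 mulmx0.
by rewrite (split_off_trace E bau Ta) mxtrace1 subr_eq0 => /eqP.
Qed.

End Local.

(** * Permutations of prime order *)

Section PrimeOrder.
Variables (p : nat) (p_prime : prime p) (V : finType) (x : {perm V}).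
Hypothesis x_order : #[x]%g = p.

Lemma perm_prime_free k v : (0 < k < p)%N -> (x ^+ k)%g v = v -> x v = v.
Proof.
case/andP=> k0 kp xkv.
have : generator <[x]>%g (x ^+ k)%g.
  by rewrite generator_coprime x_order prime_coprime // gtnNdvd.
move/eqP=> gen; have : x \in <[(x ^+ k)%g]>%g by rewrite -gen cycle_id.
case/cycleP=> j {1}->.
by elim: j => [|j IH]; rewrite ?perm1 // expgS permM xkv.
Qed.

Lemma perm_prime_inj v :
  x v != v -> injective (fun k : 'I_p => (x ^+ k)%g v).
Proof.
move=> xv i j; wlog le_ij : i j / (i <= j)%N.
  by move=> W; case/orP: (leq_total i j) => /W IH // /esym/IH.
move=> xij; apply: val_inj; apply/eqP; rewrite eqn_leq le_ij /= leqNgt.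
apply: contraNN xv => lt_ij; apply/eqP; apply: (@perm_prime_free (j - i)).
  by rewrite subn_gt0 lt_ij (leq_ltn_trans (leq_subr _ _)).
by apply: (@perm_inj _ (x ^+ i)%g); rewrite -permM -expgD subnK.
Qed.

(** The predicate d selects one point in each regular orbit. *)
Lemma perm_prime_transversal : exists d : pred V,
  forall v, (\sum_(k < p) d ((x ^+ k)%g v) = (x v != v))%N.
Proof.
pose r v := odflt v [pick u in porbit x v].
exists (fun v => (x v != v) && (r v == v)) => v.
have fixX k : (x ((x ^+ k)%g v) == (x ^+ k)%g v) = (x v == v).
  by rewrite -permM -expgSr expgS permM (inj_eq perm_inj).
have [xv|xv] := eqVneq (x v) v.
  by rewrite big1 // => k _; rewrite fixX xv eqxx.
have rX k : r ((x ^+ k)%g v) = r v.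
  rewrite /r; have -> : porbit x ((x ^+ k)%g v) = porbit x v.
    by apply/eqP; rewrite eq_porbit_mem mem_porbit.
  by case: pickP => // /(_ v); rewrite porbit_id.
have : r v \in porbit x v.
  by rewrite /r; case: pickP => // /(_ v); rewrite porbit_id.
case/porbitP => k0 rv.
have xmod j : (x ^+ (j %% p) = x ^+ j)%g by rewrite -x_order expg_mod_order.
have k0p : (k0 %% p < p)%N by rewrite ltn_mod prime_gt0.
rewrite (bigD1 (Ordinal k0p)) //= fixX xv rX rv xmod eqxx.
rewrite big1 // => k kN; rewrite fixX xv rX rv /=.
case: eqP => // E; case/eqP: kN; apply: (perm_prime_inj xv).
by rewrite /= -E xmod.
Qed.

End PrimeOrder.

Section PermutationMatrix.
Variables (R : comNzRingType) (V : finType) (x : {perm V}).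

Definition perm_index (i : 'I_#|V|) := enum_rank (x (enum_val i)).

Lemma iter_perm_index k i :
  iter k perm_index i = enum_rank ((x ^+ k)%g (enum_val i)).
Proof.
elim: k => [|k IH]; first by rewrite perm1 enum_valK.
by rewrite iterS IH /perm_index enum_rankK expgSr permM.
Qed.

Lemma permutation_mxE : permutation_mx R x = fun_mx R perm_index.
Proof.
apply/matrixP=> i j; rewrite !mxE -[X in X == perm_index j]enum_valK.
by rewrite (inj_eq enum_rank_inj).
Qed.

Definition set_inclusion_mx (S : {set V}) : 'M[R]_(#|V|, #|S|) :=
  fun_mx R (fun j : 'I_#|S| => enum_rank (enum_val j)).

Lemma principal_submxE (S : {set V}) (M : 'M[R]_#|V|) :
  principal_submx S M = (set_inclusion_mx S)^T *m M *m set_inclusion_mx S.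
Proof. by apply/matrixP=> i j; rewrite [RHS]mul_fun_mx tr_fun_mx_mul mxE. Qed.

Lemma set_inclusion_mx_mul_tr (S : {set V}) i j :
  (set_inclusion_mx S *m (set_inclusion_mx S)^T) i j
  = ((i == j) && (enum_val i \in S))%:R.
Proof.
rewrite mxE; under eq_bigr do rewrite !mxE.
rewrite -(big_enum_val
            (fun v => (i == enum_rank v)%:R * (j == enum_rank v)%:R)).
have [iS|iS] := boolP (enum_val i \in S); last first.
  rewrite andbF big1 // => v vS; case: eqP => [iv|]; last by rewrite mul0r.
  by rewrite iv enum_rankK vS in iS.
rewrite (bigD1 (enum_val i)) //= enum_valK eqxx mul1r andbT eq_sym.
rewrite big1 ?addr0 // => v /andP[_ vN].
case: eqP => [iv|]; last by rewrite mul0r.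
by rewrite iv enum_rankK eqxx in vN.
Qed.

Lemma permutation_fixed_point_data p :
    prime p -> #[x]%g = p ->
  exists D, fixed_point_data p (permutation_mx R x)
              (set_inclusion_mx (fixed_vertices x)) D.
Proof.
move=> p_prime x_order.
(* the diagonal entries of the translates of D involve the inverse of x *)
have [d dE] := perm_prime_transversal p_prime (etrans (orderV x) x_order).
exists (\matrix_(i, j) ((i == j) && d (enum_val j))%:R).
have xp : (x ^+ p = 1)%g by rewrite -x_order expg_order.
have fixed (j : 'I_#|fixed_vertices x|) : x (enum_val j) = enum_val j.
  by have := enum_valP j; rewrite inE => /eqP.
rewrite permutation_mxE; split.
- rewrite fun_mxX; apply/matrixP=> i j; rewrite !mxE iter_perm_index xp perm1.
  by rewrite enum_valK.
- apply/matrixP=> i j; rewrite mul_fun_mx !mxE /perm_index enum_rankK.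
  by rewrite fixed.
- apply/matrixP=> i j; rewrite tr_fun_mx_mul !mxE; congr (nat_of_bool _)%:R.
  rewrite /perm_index -(inj_eq enum_val_inj) !enum_rankK -(fixed i).
  rewrite (inj_eq perm_inj) -[j in RHS]enum_valK (inj_eq enum_rank_inj).
  by rewrite eq_sym fixed.
apply/matrixP=> i j.
rewrite summxE mxE [X in _ + X]mxE set_inclusion_mx_mul_tr mxE.
transitivity
  (\sum_(k < p) ((i == j) && d ((x^-1 ^+ k)%g (enum_val j)))%:R : R).
  have [->|ij] /= := eqVneq i j; last by rewrite subrr big1.
  rewrite -natr_sum dE inE -(inj_eq (@perm_inj _ x) (x^-1%g _)) permKV.
  by rewrite [_ == x _]eq_sym; case: eqP => _; rewrite ?subrr ?subr0.
apply: eq_bigr => k _; rewrite -exprM !fun_mxX mul_fun_mx mxE.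
set u := iter _ _ j.
have uE : u = enum_rank ((x^-1 ^+ k)%g (enum_val j)).
  have -> : (x^-1 = x ^+ p.-1)%g.
    by apply/eqP; rewrite eq_invg_mul -expgS prednK ?prime_gt0 // xp.
  by rewrite /u iter_perm_index expgM.
rewrite (bigD1 u) //= big1 ?addr0 => [|v /negPf vN]; last first.
  by rewrite !mxE vN mulr0.
rewrite !mxE eqxx /= uE enum_rankK iter_perm_index enum_rankK expgVn permKV.
by rewrite enum_valK; case: eqP; rewrite ?mul1r ?mul0r.
Qed.

End PermutationMatrix.

(** * The trace on a scalar extension *)

(** Any expansion of phi into endomorphisms of rank one yields its trace, with
    no reference to the basis in which the trace is defined. *)
Lemma lfun_trace_sum (K : fieldType) (W : vectType K) n (chi : 'I_n -> W -> K)
    (y : 'I_n -> W) (phi : 'End(W)) :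
    (forall u a w w', chi u (a *: w + w') = a * chi u w + chi u w') ->
    (forall w, phi w = \sum_u chi u w *: y u) ->
  lfun_trace phi = \sum_u chi u (y u).
Proof.
move=> chiL phiE; set b := vbasis {:W}.
have b_basis : basis_of {:W} b by exact: vbasisP.
have chi0 u : chi u 0 = 0.
  by have := chiL u (-1) 0 0; rewrite scaler0 addr0 mulN1r addNr.
have chi_sum u (a : 'I_(\dim {:W}) -> K) :
    chi u (\sum_i a i *: b`_i) = \sum_i a i * chi u b`_i.
  elim/big_rec2: _ => [|i z w _ IH]; first exact: chi0.
  by rewrite chiL IH.
have -> : lfun_trace phi = \sum_i coord b i (phi b`_i).
  apply: eq_bigr => i _; rewrite mxE !mxE /=; congr (coord b i (phi _)).
  by rewrite -[RHS](passmx.rVofK b_basis) passmx.rVofE.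
under eq_bigr do rewrite phiE linear_sum /=.
rewrite exchange_big /=; apply: eq_bigr => u _.
rewrite [in RHS](coord_vbasis (memvf (y u))) chi_sum.
by apply: eq_bigr => i _; rewrite linearZ /= mulrC.
Qed.

Lemma fraction_denominator (O : idomainType) (a : {fraction O}) :
  exists c d : O, d != 0 /\ d%:F * a = c%:F.
Proof.
elim/quotW: a => r; exists \n_r, \d_r; split; first exact: denom_ratioP.
rewrite !piE /=; apply/eqmodP; rewrite /= FracField.equivfE /FracField.mulf.
rewrite !numden_Ratio ?mulf_neq0 ?oner_neq0 ?denom_ratioP //.
by rewrite !mul1r mulr1 mulrC.
Qed.

Lemma tofrac_semilinear (O : idomainType) (W M : lmodType {fraction O})
    (h : W -> M) :
    (forall (c : O) w w', h (c%:F *: w + w') = c%:F *: h w + h w') ->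
  forall a w w', h (a *: w + w') = a *: h w + h w'.
Proof.
move=> hL a w w'.
have h0 : h 0 = 0.
  by have := hL (-1) 0 0; rewrite !rmorphN1 scaler0 addr0 scaleN1r addNr.
have hD u v : h (u + v) = h u + h v.
  by have := hL 1 u v; rewrite rmorph1 !scale1r.
have hZ (c : O) u : h (c%:F *: u) = c%:F *: h u.
  by have := hL c u 0; rewrite h0 !addr0.
rewrite hD; congr (_ + _).
have [c [d [d0 da]]] := fraction_denominator a.
have dF : d%:F != 0 by rewrite tofrac_eq0.
by apply: (scalerI dF); rewrite -hZ !scalerA da hZ.
Qed.

(** The universal property of the scalar extension speaks of O-modules, but it
    is applied to vector spaces over the field of fractions. *)
Section RestrictionOfScalars.
Variables (O : idomainType) (M : lmodType {fraction O}).

Definition restr_scalars : Type := M.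

HB.instance Definition _ := GRing.Zmodule.on restr_scalars.

Definition restr_scale (c : O) (m : restr_scalars) : restr_scalars :=
  c%:F *: (m : M).

Fact restr_scaleA c d m :
  restr_scale c (restr_scale d m) = restr_scale (c * d) m.
Proof. by rewrite /restr_scale scalerA rmorphM. Qed.

Fact restr_scale1 : left_id 1 restr_scale.
Proof. by move=> m; rewrite /restr_scale rmorph1 scale1r. Qed.

Fact restr_scaleDr : right_distributive restr_scale +%R.
Proof. by move=> c m m'; rewrite /restr_scale scalerDr. Qed.

Fact restr_scaleDl m : {morph restr_scale^~ m : c d / c + d}.
Proof. by move=> c d; rewrite /restr_scale rmorphD scalerDl. Qed.

HB.instance Definition _ := GRing.Zmodule_isLmodule.Build O restr_scalars
  restr_scaleA restr_scale1 restr_scaleDr restr_scaleDl.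

End RestrictionOfScalars.

(** Existence in the universal property, for the inclusion of L in K^n, gives
    the map chi to K^n; uniqueness, for maps to W itself, shows that the
    elements 1 (x) E e_u expand w with the coordinates of chi w. *)
Lemma induced_endo_trace (O : idomainType) n (E T : 'M[O]_n)
    (W : vectType {fraction O}) (t : {fraction O} -> image_module E -> W)
    (phi : 'End(W)) :
    E *m E = E -> E *m T = T *m E -> is_scalar_extension t ->
    induced_endo T t phi ->
  lfun_trace phi = (\tr (T *m E))%:F.
Proof.
move=> EE ET [t1 t2 tZ univ] phit.
pose K := {fraction O}.
have LP (l : image_module E) : E *m image_val l = image_val l.
  by case: l => l /= /asboolP[w ->]; rewrite mulmxA EE.
have gP (w : 'cV[O]_n) : E *m w \in mximage E by apply/asboolP; exists w.
pose g u := ImageModule (gP (delta_mx u 0)).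
have lE (l : image_module E) : l = \sum_u image_val l u 0 *: g u.
  apply: val_inj; rewrite raddf_sum -[LHS]LP /=.
  rewrite [in LHS](matrix_sum_delta (image_val l)) mulmx_sumr.
  by apply: eq_bigr => u _; rewrite big_ord1 -scalemxAr.
have t0 k : t k 0 = 0.
  by have := t1 k (-1) 0 0; rewrite rmorphN1 scaler0 addr0 scaleN1r addNr.
have tE k l : t k l = \sum_u (k * (image_val l u 0)%:F) *: t 1 (g u).
  rewrite {1}[l]lE; elim/big_rec2: _ => [|u w l' _ IH]; first exact: t0.
  by rewrite t1 IH !tZ mulr1 mulrC.
pose emb (k : K) (l : image_module E) : restr_scalars 'cV[K]_n :=
  k *: map_mx (@FracField.tofrac O) (image_val l).
have emb_bilin : bilinear_map emb.
  split=> [k c m m'|c k k' m].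
    rewrite /emb /= raddfD /= map_mxZ scalerDr scalerA mulrC -scalerA.
    exact: erefl.
  rewrite /emb scalerDl -scalerA; exact: erefl.
have [[chi [chiO chit]] _] := univ _ _ emb_bilin.
have chiL : forall a w w',
    chi (a *: w + w') = a *: (chi w : 'cV[K]_n) + chi w' :> 'cV[K]_n.
  exact: (@tofrac_semilinear O W 'cV[K]_n chi).
have t_bilin : bilinear_map (t : K -> image_module E -> restr_scalars W).
  by split=> *; [exact: t1 | exact: t2].
have [_ uniq] := univ _ _ t_bilin.
have wE w : w = \sum_u (chi w : 'cV[K]_n) u 0 *: t 1 (g u).
  apply: (uniq id (fun w => \sum_u (chi w : 'cV[K]_n) u 0 *: t 1 (g u))).
    by split.
  split=> [c z z'|k l].
    rewrite chiL.
    have -> (v v' : restr_scalars W) :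
      c *: v + v' = c%:F *: (v : W) + v' :> W by [].
    rewrite scaler_sumr -big_split /=; apply: eq_bigr => u _.
    by rewrite !mxE scalerDl scalerA.
  by rewrite [RHS]tE chit; apply: eq_bigr => u _; rewrite !mxE.
(* T E e_u = E T e_u, so that phi (1 (x) E e_u) = 1 (x) h u *)
pose h u := ImageModule (gP (T *m delta_mx u 0)).
rewrite (@lfun_trace_sum {fraction O} W n
  (fun u w => (chi w : 'cV[K]_n) u 0) (fun u => t 1 (h u))).
- rewrite /mxtrace raddf_sum; apply: eq_bigr => u _.
  by rewrite /= chit /emb scale1r mxE /= mulmxA -colE mxE ET.
- by move=> u a w w'; rewrite chiL !mxE.
move=> w; rewrite {1}[w]wE linear_sum; apply: eq_bigr => u _.
by rewrite linearZ /=; congr (_ *: _); apply: phit; rewrite /= mulmxA ET mulmxA.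
Qed.

(** * Spectral idempotents *)

Lemma idem_comm_stable (F : fieldType) n (Q U : 'M[F]_n) :
  Q *m Q = Q -> stablemx Q U -> stablemx (kermx Q) U -> Q *m U = U *m Q.
Proof.
move=> QQ /submxP[X QU] kQ.
have QUQ : Q *m U *m Q = Q *m U by rewrite QU -mulmxA QQ.
have kQU : (1%:M - Q) *m U *m Q = 0.
  apply/sub_kermxP; apply: submx_trans kQ; apply: submxMr.
  by apply/sub_kermxP; rewrite mulmxBl mul1mx QQ subrr.
by move: kQU; rewrite !mulmxBl mul1mx QUQ => /eqP; rewrite subr_eq0 => /eqP.
Qed.

Lemma spectral_idempotent_comm (F : fieldType) n (A P T : 'M[F]_n) :
  spectral_idempotent A P -> A *m T = T *m A -> P *m T = T *m P.
Proof.
case=> s [theta [_ _ PP Pim Pker]] AT; apply: trmx_inj; rewrite !trmx_mul.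
have cAT : comm_mx A^T T^T by rewrite /comm_mx -!trmx_mul AT.
apply/esym/idem_comm_stable; first by rewrite -trmx_mul PP.
  by rewrite (eqmx_stable _ Pim) comm_mx_stable_eigenspace.
rewrite (eqmx_stable _ Pker).
elim/big_ind: _ => [|B C *|a _]; [exact: stable0mx | exact: stableDmx |].
exact: comm_mx_stable_eigenspace.
Qed.

Lemma permutation_mx_comm (R : nzRingType) (V : finType) (e : rel V)
    (x : {perm V}) :
    graph_aut e x ->
  adjmx R e *m permutation_mx R x = permutation_mx R x *m adjmx R e.
Proof.
move=> ex; apply/matrixP=> i j; rewrite !mxE.
rewrite (bigD1 (enum_rank (x (enum_val j)))) //= !mxE enum_rankK eqxx mulr1.
rewrite [RHS](bigD1 (enum_rank ((x^-1)%g (enum_val i)))) //= !mxE enum_rankK.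
rewrite permKV eqxx mul1r.
rewrite -[in RHS]ex permKV !big1 ?addr0 // => k kN; rewrite !mxE.
  case: eqP => [iE|]; last by rewrite mul0r.
  by rewrite iE permK enum_valK eqxx in kN.
case: eqP => [kE|]; last by rewrite mulr0.
by rewrite -kE enum_valK eqxx in kN.
Qed.

Lemma map_permutation_mx (R R' : nzRingType) (h : {rmorphism R -> R'})
    (V : finType) (x : {perm V}) :
  map_mx h (permutation_mx R x) = permutation_mx R' x.
Proof. by apply/matrixP=> i j; rewrite !mxE rmorph_nat. Qed.

(** * The trace formula *)

Theorem corollary4p2
  (p : nat) (p_prime : prime p)
  (O : idomainType) (O_cdvr : complete_dvr O)
  (kappa : fieldType) (pi : {rmorphism O -> kappa}) (pi_res : residue_map pi)
  (kappa_char : p \in [pchar kappa])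
  (K_char : [pchar {fraction O}] =i pred0)
  (V : finType) (e : rel V) (e_sym : symmetric e) (e_irr : irreflexive e)
  (x : {perm V}) (x_aut : graph_aut e x) (x_order : #[x]%g = p) :
  let T := permutation_mx O x in
  (forall E : 'M[O]_#|V|,
     E *m E = E -> E *m T = T *m E -> trace_rank_formula pi x E) /\
  (forall (F : fieldType) (iota : {rmorphism {fraction O} -> F})
          (E : 'M[O]_#|V|),
     spectral_idempotent (adjmx F e) (map_mx (fun a : O => iota a%:F) E) ->
     [/\ E *m E = E, E *m T = T *m E & trace_rank_formula pi x E]).
Proof.
move=> T; have [pi_surj pi_nonunit] := pi_res.
have pi_unit (a : O) : pi a != 0 -> a \is a GRing.unit.
  by apply: contraNT => /pi_nonunit ->.
have formula (E : 'M[O]_#|V|) :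
    E *m E = E -> E *m T = T *m E -> trace_rank_formula pi x E.
  move=> EE ET; split=> [W t phi|]; first exact: induced_endo_trace.
  have [D TJD] := permutation_fixed_point_data O p_prime x_order.
  rewrite principal_submxE !map_mxM -map_trmx -/T.
  rewrite (trace_eq_rank pi_surj pi_unit p_prime kappa_char TJD) //.
  exact: rmorph_nat.
split=> // F iota E spE.
pose j : {rmorphism O -> F} := iota \o @FracField.tofrac O.
have j_inj : injective (map_mx j : 'M_#|V| -> 'M_#|V|).
  move=> A B AB; apply/matrixP=> a b; have /matrixP/(_ a b) := AB.
  by rewrite !mxE => /fmorph_inj/eqP; rewrite tofrac_eq => /eqP.
have jT : map_mx j T = permutation_mx F x by exact: map_permutation_mx.
have EE : E *m E = E.
  by case: spE => s [theta [_ _ PP _ _]]; apply: j_inj; rewrite map_mxM.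
have ET : E *m T = T *m E.
  apply: j_inj; rewrite !map_mxM jT.
  exact: (spectral_idempotent_comm spE (permutation_mx_comm F x_aut)).
by split=> //; apply: formula.
Qed.
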